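(* Let $M$ be a finite monoid, $K$ a subgroup of the group of units $G(M)$ of $M$, and $F$ a field of characteristic not dividing $|K|$. Let $(\pi,V)$ be an irreducible representation of $M$ over $F$ with $V^K\neq\{0\}$. Then $V^K$ is irreducible as an $\mathcal{H}_K$-module.
   Context: A representation $(\pi,V)$ of a monoid $M$ over $F$ is an $F$-vector space $V$ together with a monoid homomorphism $\pi:M\to \mathrm{End}_F(V)$ (in particular $\pi(1)=\mathrm{id}_V$). It is irreducible if $V\neq 0$ and $V$ has no proper nonzero $M$-stable subspaces. $V^K=\{v\in V : \pi(k)v=v \text{ for all } k\in K\}$. For functions $\phi,\psi:M\to F$, the convolution product is $(\phi*\psi)(m)=\sum_{y,z\in M,\ yz=m}\phi(y)\psi(z)$. $\mathcal{H}_K$ is the $F$-algebra, under addition and convolution, of functions $\phi:M\to F$ satisfying $\phi(k_1mk_2)=\phi(m)$ for all $k_1,k_2\in K$ and $m\in M$. For $\phi:M\to F$, define $\pi(\phi)v=\sum_{x\in M}\phi(x)\pi(x)v$ for $v\in V$. The algebra $\mathcal{H}_K$ acts on $V^K$ by $\phi\cdot v=\pi(\phi)v$. *)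

(* Defs.v *)
From HB Require Import structures.
From mathcomp Require Import all_boot all_order all_algebra all_fingroup.
From mathcomp Require Import boolp classical_sets.

Set Implicit Arguments.
Unset Strict Implicit.
Unset Printing Implicit Defensive.

Import GRing.Theory.
Local Open Scope ring_scope.

(* A packed record rather than an HB join of Monoid and Finite: FinStarMonoid
   already inherits from both, so HB rejects a new structure below it. *)
Record finMonoidType := FinMonoid {
  finmonoid_finType : finType;
  finmonoid_mul : finmonoid_finType -> finmonoid_finType -> finmonoid_finType;
  finmonoid_one : finmonoid_finType;
  finmonoid_mulA : associative finmonoid_mul;
  finmonoid_mul1 : left_id finmonoid_one finmonoid_mul;
  finmonoid_mulr1 : right_id finmonoid_one finmonoid_mul
}.

Definition finmonoid_sort (M : finMonoidType) : Type := finmonoid_finType M.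
Coercion finmonoid_sort : finMonoidType >-> Sortclass.

HB.instance Definition _ (M : finMonoidType) :=
  Finite.copy (finmonoid_sort M) (finmonoid_finType M).
HB.instance Definition _ (M : finMonoidType) :=
  isMonoid.Build (finmonoid_sort M)
    (@finmonoid_mulA M) (@finmonoid_mul1 M) (@finmonoid_mulr1 M).

Section UnitGroup.
Variable M : finMonoidType.
Implicit Types x y : M.

Definition invertible : pred M :=
  fun x => [exists y : M, (x * y == 1)%g && (y * x == 1)%g].

Definition unit_group : Type := {x : M | invertible x}.
HB.instance Definition _ := SubType.on unit_group.
HB.instance Definition _ := [Finite of unit_group by <:].

Implicit Types g h : unit_group.

Fact invertible1 : invertible 1%g.
Proof. by apply/existsP; exists 1%g; rewrite mulg1 eqxx. Qed.

Fact invertibleM x y : invertible x -> invertible y -> invertible (x * y)%g.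
Proof.
case/existsP=> x' /andP[/eqP xx' /eqP x'x].
case/existsP=> y' /andP[/eqP yy' /eqP y'y].
apply/existsP; exists (y' * x')%g; apply/andP; split; apply/eqP.
  by rewrite mulgA -(mulgA x) yy' mulg1.
by rewrite mulgA -(mulgA y') x'x mulg1.
Qed.

Definition inverse x : M :=
  odflt 1%g [pick y | (x * y == 1)%g && (y * x == 1)%g].

Fact inverseP x : invertible x ->
  (x * inverse x = 1)%g /\ (inverse x * x = 1)%g.
Proof.
move=> /existsP[y xy]; rewrite /inverse; case: pickP => [z|/(_ y)].
  by case/andP=> /eqP ? /eqP ?.
by rewrite xy.
Qed.

Fact invertibleV x : invertible x -> invertible (inverse x).
Proof.
move=> /inverseP[xx' x'x]; apply/existsP; exists x.
by rewrite xx' x'x eqxx.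
Qed.

Definition unit_one : unit_group := Sub 1%g invertible1.
Definition unit_mul g h : unit_group :=
  Sub (val g * val h)%g (invertibleM (valP g) (valP h)).
Definition unit_inv g : unit_group :=
  Sub (inverse (val g)) (invertibleV (valP g)).

Fact unit_mulA : associative unit_mul.
Proof. by move=> f g h; apply: val_inj; rewrite /= mulgA. Qed.
Fact unit_mul1 : left_id unit_one unit_mul.
Proof. by move=> g; apply: val_inj; rewrite /= mul1g. Qed.
Fact unit_mulr1 : right_id unit_one unit_mul.
Proof. by move=> g; apply: val_inj; rewrite /= mulg1. Qed.
Fact unit_mulV : left_inverse unit_one unit_inv unit_mul.
Proof. by move=> g; apply: val_inj; rewrite /= (inverseP (valP g)).2. Qed.
Fact unit_mulrV : right_inverse unit_one unit_inv unit_mul.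
Proof. by move=> g; apply: val_inj; rewrite /= (inverseP (valP g)).1. Qed.

HB.instance Definition _ := isGroup.Build unit_group
  unit_mulA unit_mul1 unit_mulr1 unit_mulV unit_mulrV.

Lemma val_unitM g h : val (g * h)%g = (val g * val h)%g.
Proof. by []. Qed.

Lemma val_unit1 : val (1%g : unit_group) = 1%g.
Proof. by []. Qed.

End UnitGroup.

Section Representations.
Variables (F : fieldType) (M : finMonoidType) (V : lmodType F).

Record representation := Representation {
  repr_fun :> M -> {linear V -> V};
  repr1 : forall v, repr_fun 1%g v = v;
  reprM : forall x y v, repr_fun (x * y)%g v = repr_fun x (repr_fun y v)
}.

(* W : set V is an arbitrary Prop-valued subset; [in W] is its (classical)
   boolean membership predicate, as submod_closed expects. *)
Definition irreducible_representation (pi : representation) : Prop :=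
  (exists v : V, v != 0) /\
  forall W : set V, submod_closed [in W] ->
    (forall (x : M) (w : V), w \in W -> pi x w \in W) ->
    W = [set 0]%classic \/ W = setT.

Definition fixed_points (pi : representation) (K : {set unit_group M}) :
    {pred V} :=
  [pred v | [forall k in K, pi (val k) v == v]].

Lemma fixed_pointsP (pi : representation) (K : {set unit_group M}) v :
  reflect (forall k, k \in K -> pi (val k) v = v) (v \in fixed_points pi K).
Proof. exact: 'forall_in_eqP. Qed.

(* F^o rather than F: this is the type whose pointwise scaling by F the library
   declares as canonical. *)
Definition repr_act (pi : representation) (phi : {ffun M -> F^o}) (v : V) : V :=
  \sum_(x : M) phi x *: pi x v.

End Representations.

Definition irreducible_module (R : pzRingType) (V : lmodType R) : Prop :=
  (exists v : V, v != 0) /\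
  forall W : set V, submod_closed [in W] -> W = [set 0]%classic \/ W = setT.

(* [pchar F] is empty in characteristic 0, which divides no n > 0. *)
Definition pchar_ndvd (F : fieldType) (n : nat) : Prop :=
  forall p, p \in [pchar F] -> ~~ (p %| n)%N.

Lemma pchar_ndvd_neq0 (F : fieldType) n :
  (0 < n)%N -> pchar_ndvd F n -> n%:R != 0 :> F.
Proof.
move=> n_gt0 charFn; apply/negP => n0.
have [p pF] := natf0_pchar n_gt0 n0.
by move: (charFn p pF); rewrite (dvdn_pcharf pF) n0.
Qed.

Section Convolution.
Variables (F : fieldType) (M : finMonoidType).
Implicit Types (phi psi chi : {ffun M -> F^o}).

Definition convolution phi psi : {ffun M -> F^o} :=
  [ffun m => \sum_(yz : M * M | (yz.1 * yz.2)%g == m) phi yz.1 * psi yz.2].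

Lemma sum_convolution (W : lmodType F) phi psi (f : M -> W) :
  \sum_m convolution phi psi m *: f m =
  \sum_y \sum_z (phi y * psi z) *: f (y * z)%g.
Proof.
rewrite pair_bigA /=.
rewrite (partition_big (fun yz : M * M => (yz.1 * yz.2)%g) predT) //=.
apply: eq_bigr => m _; rewrite ffunE scaler_suml.
by apply: eq_bigr => yz /eqP->.
Qed.

Lemma convolutionE phi psi m :
  convolution phi psi m = \sum_y \sum_z phi y * psi z * ((y * z)%g == m)%:R.
Proof.
rewrite ffunE pair_bigA /= big_mkcond /=; apply: eq_bigr => yz _.
by case: ifP; rewrite ?mulr1 ?mulr0.
Qed.

Lemma convolutionA : associative convolution.
Proof.
move=> phi psi chi; apply/ffunP => m; rewrite !convolutionE.
pose f y x : F^o := ((y * x)%g == m)%:R.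
transitivity (\sum_y \sum_z \sum_w phi y * psi z * chi w *
                ((y * z * w)%g == m)%:R).
  apply: eq_bigr => y _.
  transitivity (\sum_x convolution psi chi x *: (phi y *: f y x)).
    by apply: eq_bigr => x _; rewrite -mulrA mulrCA.
  rewrite sum_convolution; apply: eq_bigr => z _; apply: eq_bigr => w _.
  by rewrite /f mulgA /GRing.scale /= !mulrA (mulrC _ (phi y)) !mulrA.
transitivity (\sum_x convolution phi psi x *: (\sum_w chi w * f x w : F^o)).
  rewrite sum_convolution; apply: eq_bigr => y _; apply: eq_bigr => z _.
  rewrite /GRing.scale /= mulr_sumr.
  by apply: eq_bigr => w _; rewrite /f !mulrA.
apply: eq_bigr => x _; rewrite /GRing.scale /= mulr_sumr.
by apply: eq_bigr => w _; rewrite mulrA.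
Qed.

Lemma convolutionDl : left_distributive convolution +%R.
Proof.
move=> phi psi chi; apply/ffunP => m; rewrite !ffunE -big_split /=.
by apply: eq_bigr => yz _; rewrite !ffunE mulrDl.
Qed.

Lemma convolutionDr : right_distributive convolution +%R.
Proof.
move=> phi psi chi; apply/ffunP => m; rewrite !ffunE -big_split /=.
by apply: eq_bigr => yz _; rewrite !ffunE mulrDr.
Qed.

Lemma convolutionZl (a : F) phi psi :
  a *: convolution phi psi = convolution (a *: phi) psi.
Proof.
apply/ffunP => m; rewrite !ffunE scaler_sumr.
by apply: eq_bigr => yz _; rewrite !ffunE scalerAl.
Qed.

Lemma convolutionZr (a : F) phi psi :
  a *: convolution phi psi = convolution phi (a *: psi).
Proof.
apply/ffunP => m; rewrite !ffunE scaler_sumr.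
by apply: eq_bigr => yz _; rewrite !ffunE scalerAr.
Qed.

Section Biinvariant.
Variable K : {group unit_group M}.

Definition biinvariant : {pred {ffun M -> F^o}} :=
  [pred phi : {ffun M -> F^o} | [forall k1 in K, forall k2 in K, forall m : M,
    phi (val k1 * m * val k2)%g == phi m]].

Lemma biinvariantP phi :
  reflect {in K &, forall k1 k2 m, phi (val k1 * m * val k2)%g = phi m}
          (phi \in biinvariant).
Proof.
apply: (iffP 'forall_in_forall_inP)
  => [phiK k1 k2 k1K k2K m|phiK k1 k1K k2 k2K].
  by have /forallP/(_ m)/eqP := phiK k1 k1K k2 k2K.
by apply/forallP => m; rewrite phiK.
Qed.

Lemma biinvariantl phi k m :
  phi \in biinvariant -> k \in K -> phi (val k * m)%g = phi m.
Proof.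
by move=> /biinvariantP phiK kK; rewrite -[RHS](phiK k 1%g) ?group1 ?mulg1.
Qed.

Lemma biinvariantr phi k m :
  phi \in biinvariant -> k \in K -> phi (m * val k)%g = phi m.
Proof.
by move=> /biinvariantP phiK kK; rewrite -[RHS](phiK 1%g k) ?group1 ?mul1g.
Qed.

Lemma val_unitVM (k : unit_group M) m : (val k^-1 * (val k * m))%g = m.
Proof. by rewrite mulgA -val_unitM mulVg mul1g. Qed.

Lemma val_unitMV (k : unit_group M) m : (val k * (val k^-1 * m))%g = m.
Proof. by rewrite mulgA -val_unitM mulgV mul1g. Qed.

Lemma val_unitMr (k : unit_group M) m : (m * val k * val k^-1)%g = m.
Proof. by rewrite -mulgA -val_unitM mulgV mulg1. Qed.

Lemma val_unitMVr (k : unit_group M) m : (m * val k^-1 * val k)%g = m.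
Proof. by rewrite -mulgA -val_unitM mulVg mulg1. Qed.

Lemma biinvariant_submod : submod_closed biinvariant.
Proof.
split=> [|a phi psi /biinvariantP phiK /biinvariantP psiK].
  by apply/biinvariantP => k1 k2 _ _ m; rewrite !ffunE.
by apply/biinvariantP => k1 k2 k1K k2K m; rewrite !ffunE phiK ?psiK.
Qed.

Lemma biinvariant_convolution phi psi :
  phi \in biinvariant -> psi \in biinvariant ->
  convolution phi psi \in biinvariant.
Proof.
move=> phiK psiK; apply/biinvariantP => k1 k2 k1K k2K m; rewrite !ffunE.
pose h (yz : M * M) : M * M := (val k1 * yz.1, yz.2 * val k2)%g.
pose h' (yz : M * M) : M * M := (val k1^-1 * yz.1, yz.2 * val k2^-1)%g.
have hK : cancel h h' by case=> y z; rewrite /h /h' /= val_unitVM val_unitMr.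
have h'K : cancel h' h by case=> y z; rewrite /h /h' /= val_unitMV val_unitMVr.
rewrite (reindex h) /=; last by exists h' => yz _; [apply: hK | apply: h'K].
apply: eq_big => [[y z]|[y z] _] /=; last first.
  by rewrite (biinvariantl _ phiK k1K) (biinvariantr _ psiK k2K).
rewrite mulgA -(mulgA _ y); apply/eqP/eqP => [e|->//].
by rewrite -[LHS](val_unitVM k1) -[X in (_ * X)%g](val_unitMr k2) e
           val_unitMr val_unitVM.
Qed.

Definition hecke_one : {ffun M -> F^o} :=
  [ffun m => if m \in [set val k | k in K] then #|K|%:R^-1 else 0].

Lemma sum_hecke_one (W : lmodType F) (f : M -> W) :
  \sum_m hecke_one m *: f m = #|K|%:R^-1 *: \sum_(k in K) f (val k).
Proof.
rewrite scaler_sumr -(big_imset (fun m => #|K|%:R^-1 *: f m)) /=; last first.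
  by move=> k1 k2 _ _; apply: val_inj.
rewrite [RHS]big_mkcond /=; apply: eq_bigr => m _; rewrite ffunE.
by case: ifP; rewrite ?scale0r.
Qed.

Lemma biinvariant_one : hecke_one \in biinvariant.
Proof.
apply/biinvariantP => k1 k2 k1K k2K m; rewrite !ffunE.
congr (if _ then _ else _); apply/imsetP/imsetP => -[k kK def_m].
  exists (k1^-1 * k * k2^-1)%g; first by rewrite !groupM ?groupV.
  by rewrite !val_unitM -def_m -!mulgA val_unitVM mulgA val_unitMr.
by exists (k1 * k * k2)%g; rewrite ?groupM // !val_unitM def_m.
Qed.

Hypothesis charK : pchar_ndvd F #|K|.

Let cardK_neq0 : #|K|%:R != 0 :> F.
Proof. exact: pchar_ndvd_neq0 (cardG_gt0 K) charK. Qed.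

Lemma convolution_onel phi :
  phi \in biinvariant -> convolution hecke_one phi = phi.
Proof.
move=> phiK; apply/ffunP => m; rewrite convolutionE.
transitivity (\sum_y hecke_one y *:
    (\sum_z phi z * ((y * z)%g == m)%:R : F^o)).
  apply: eq_bigr => y _; rewrite /GRing.scale /= mulr_sumr.
  by apply: eq_bigr => z _; rewrite mulrA.
rewrite sum_hecke_one (eq_bigr (fun=> phi m : F^o)) => [|k kK].
  by rewrite sumr_const -[phi m *+ _]mulr_natl scalerA mulVf ?scale1r.
rewrite (bigD1 (val k^-1 * m)%g) // val_unitMV eqxx mulr1.
rewrite (biinvariantl _ phiK) ?groupV // big1; [exact: addr0 | move=> z z_neq].
case: eqP => [def_m|_]; last by rewrite mulr0.
by rewrite -def_m val_unitVM eqxx in z_neq.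
Qed.

Lemma convolution_oner phi :
  phi \in biinvariant -> convolution phi hecke_one = phi.
Proof.
move=> phiK; apply/ffunP => m; rewrite convolutionE exchange_big /=.
transitivity (\sum_z hecke_one z *:
    (\sum_y phi y * ((y * z)%g == m)%:R : F^o)).
  apply: eq_bigr => z _; rewrite /GRing.scale /= mulr_sumr.
  by apply: eq_bigr => y _; rewrite mulrA (mulrC (phi y)).
rewrite sum_hecke_one (eq_bigr (fun=> phi m : F^o)) => [|k kK].
  by rewrite sumr_const -[phi m *+ _]mulr_natl scalerA mulVf ?scale1r.
rewrite (bigD1 (m * val k^-1)%g) // val_unitMVr eqxx mulr1.
rewrite (biinvariantr _ phiK) ?groupV // big1; [exact: addr0 | move=> y y_neq].
case: eqP => [def_m|_]; last by rewrite mulr0.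
by rewrite -def_m val_unitMr eqxx in y_neq.
Qed.

End Biinvariant.
End Convolution.

Arguments biinvariant F {M} K.
Arguments hecke_one F {M} K.
Arguments biinvariant_submod F {M} K.
Arguments biinvariant_one F {M} K.

(* The identity of this algebra is 1_K / |K|, so its ring structure depends on
   the proof charK that |K| is invertible in F. *)
Definition hecke_algebra (F : fieldType) (M : finMonoidType)
    (K : {group unit_group M}) (charK : pchar_ndvd F #|K|) : Type :=
  {phi : {ffun M -> F^o} | phi \in biinvariant F K}.

Section HeckeAlgebra.
Variables (F : fieldType) (M : finMonoidType) (K : {group unit_group M}).
Variable charK : pchar_ndvd F #|K|.
Local Notation H := (hecke_algebra charK).
Implicit Types phi psi chi : H.

HB.instance Definition _ := SubType.on H.
HB.instance Definition _ := Choice.on H.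
HB.instance Definition _ := GRing.SubChoice_isSubLmodule.Build F
  {ffun M -> F^o} (mem (biinvariant F K)) H
  (GRing.submod_closed_semi (biinvariant_submod F K)).

Definition hecke_unit : H := Sub (hecke_one F K) (biinvariant_one F K).

Definition hecke_mul phi psi : H :=
  Sub (convolution (val phi) (val psi))
      (biinvariant_convolution (valP phi) (valP psi)).

Fact hecke_mulA : associative hecke_mul.
Proof. by move=> phi psi chi; apply: val_inj; rewrite /= convolutionA. Qed.
Fact hecke_mul1 : left_id hecke_unit hecke_mul.
Proof.
by move=> phi; apply: val_inj; rewrite /= (convolution_onel charK (valP phi)).
Qed.
Fact hecke_mulr1 : right_id hecke_unit hecke_mul.
Proof.
by move=> phi; apply: val_inj; rewrite /= (convolution_oner charK (valP phi)).
Qed.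
Fact hecke_mulDl : left_distributive hecke_mul +%R.
Proof. by move=> phi psi chi; apply: val_inj; rewrite /= convolutionDl. Qed.
Fact hecke_mulDr : right_distributive hecke_mul +%R.
Proof. by move=> phi psi chi; apply: val_inj; rewrite /= convolutionDr. Qed.
Fact hecke_unit_neq0 : hecke_unit != 0.
Proof.
apply/eqP => /(congr1 val) /ffunP/(_ 1%g) /eqP; rewrite !ffunE.
rewrite (_ : 1%g \in _) ?invr_eq0 ?(negPf (pchar_ndvd_neq0 _ charK)) //.
by apply/imsetP; exists 1%g; rewrite ?group1.
Qed.

HB.instance Definition _ := GRing.Zmodule_isNzRing.Build H
  hecke_mulA hecke_mul1 hecke_mulr1 hecke_mulDl hecke_mulDr hecke_unit_neq0.

Fact hecke_scaleAl (a : F) phi psi : a *: (phi * psi) = (a *: phi) * psi.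
Proof. by apply: val_inj; rewrite /= convolutionZl. Qed.
Fact hecke_scaleAr (a : F) phi psi : a *: (phi * psi) = phi * (a *: psi).
Proof. by apply: val_inj; rewrite /= convolutionZr. Qed.

HB.instance Definition _ := GRing.Lmodule_isLalgebra.Build F H hecke_scaleAl.
HB.instance Definition _ := GRing.Lalgebra_isAlgebra.Build F H hecke_scaleAr.

End HeckeAlgebra.

(* charK only serves to determine the scalar ring of this module. *)
Definition fixed_module (F : fieldType) (M : finMonoidType) (V : lmodType F)
    (pi : representation M V) (K : {group unit_group M})
    (charK : pchar_ndvd F #|K|) : Type :=
  {v : V | v \in fixed_points pi K}.

Section FixedModule.
Variables (F : fieldType) (M : finMonoidType) (V : lmodType F).
Variables (pi : representation M V) (K : {group unit_group M}).
Variable charK : pchar_ndvd F #|K|.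
Local Notation H := (hecke_algebra charK).
Local Notation VK := (fixed_module pi charK).
Implicit Types (phi psi : H) (v w : VK).

Lemma fixed_points_submod : submod_closed (fixed_points pi K).
Proof.
split=> [|a v w /fixed_pointsP vK /fixed_pointsP wK].
  by apply/fixed_pointsP => k _; rewrite linear0.
by apply/fixed_pointsP => k kK; rewrite linearP vK ?wK.
Qed.

HB.instance Definition _ := SubType.on VK.
HB.instance Definition _ := Choice.on VK.
HB.instance Definition _ := GRing.SubChoice_isSubZmodule.Build
  V (mem (fixed_points pi K)) VK (GRing.submod_closedB fixed_points_submod).

Lemma repr_act_fixed (phi : {ffun M -> F^o}) (v : V) :
  phi \in biinvariant F K -> repr_act pi phi v \in fixed_points pi K.
Proof.
move=> phiK; apply/fixed_pointsP => k kK; rewrite linear_sum /=.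
rewrite [RHS](reindex (fun m => (val k * m)%g)) /=.
  by apply: eq_bigr => m _; rewrite linearZ /= reprM (biinvariantl _ phiK kK).
by exists (fun m => (val k^-1 * m)%g) => m _; rewrite (val_unitVM, val_unitMV).
Qed.

Definition hecke_scale phi v : VK :=
  Sub (repr_act pi (val phi) (val v)) (repr_act_fixed (val v) (valP phi)).

Fact hecke_scaleA phi psi v :
  hecke_scale phi (hecke_scale psi v) = hecke_scale (phi * psi) v.
Proof.
apply: val_inj; rewrite /= /repr_act sum_convolution; apply: eq_bigr => y _.
rewrite linear_sum scaler_sumr; apply: eq_bigr => z _.
by rewrite linearZ /= scalerA reprM.
Qed.

Fact hecke_scale1 : left_id 1 hecke_scale.
Proof.
move=> v; apply: val_inj; rewrite /= /repr_act sum_hecke_one.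
rewrite (eq_bigr (fun=> val v)) => [|k kK]; last first.
  exact: (fixed_pointsP _ _ _ (valP v)).
rewrite sumr_const -scaler_nat scalerA mulVf ?scale1r //.
exact: pchar_ndvd_neq0 (cardG_gt0 K) charK.
Qed.

Fact hecke_scaleDr : right_distributive hecke_scale +%R.
Proof.
move=> phi v w; apply: val_inj; rewrite /= /repr_act -big_split /=.
by apply: eq_bigr => x _; rewrite linearD scalerDr.
Qed.

Fact hecke_scaleDl v : {morph hecke_scale^~ v : phi psi / phi + psi}.
Proof.
move=> phi psi; apply: val_inj; rewrite /= /repr_act -big_split /=.
by apply: eq_bigr => x _; rewrite ffunE scalerDl.
Qed.

HB.instance Definition _ := GRing.Zmodule_isLmodule.Build H VK
  hecke_scaleA hecke_scale1 hecke_scaleDr hecke_scaleDl.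

End FixedModule.

(* Main.v *)
(** A nonzero [w] in an H_K-submodule [W] of V^K generates V, so every
    K-fixed [v] is [pi(f) w] for some [f : M -> F].  Averaging [f] over K on both
    sides gives a function in H_K which still sends [w] to [v], because [w] and
    [v] are both fixed by K; hence [v] lies in [W]. *)
Require Import Defs.
From HB Require Import structures.
From mathcomp Require Import all_boot all_order all_algebra all_fingroup.
From mathcomp Require Import boolp classical_sets.

Set Implicit Arguments.
Unset Strict Implicit.
Unset Printing Implicit Defensive.

Import GRing.Theory.
Local Open Scope ring_scope.

Section Cyclic.
Variables (F : fieldType) (M : finMonoidType) (V : lmodType F).
Variables (pi : representation M V) (w : V).

Lemma repr_actP (a : F) (f g : {ffun M -> F^o}) :
  repr_act pi (a *: f + g) w = a *: repr_act pi f w + repr_act pi g w.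
Proof.
rewrite /repr_act scaler_sumr -big_split; apply: eq_bigr => x _.
by rewrite !ffunE scalerDl scalerA.
Qed.

(** The witness is the pushforward of [f] along left multiplication by [x]. As [x] need not be
    invertible, its value at [n] sums [f] over a whole fibre. *)
Lemma repr_act_translate (x : M) (f : {ffun M -> F^o}) :
  exists g : {ffun M -> F^o}, pi x (repr_act pi f w) = repr_act pi g w.
Proof.
exists [ffun n => \sum_(m | (x * m)%g == n) f m].
rewrite /repr_act linear_sum (partition_big (fun m => (x * m)%g) predT) //=.
apply: eq_bigr => n _; rewrite ffunE scaler_suml.
by apply: eq_bigr => m /eqP<-; rewrite linearZ reprM.
Qed.

(** The vectors [repr_act pi f w] form an [M]-stable subspace containing [w], so irreducibility
    makes it all of [V]. *)
Lemma irreducible_cyclic : irreducible_representation pi -> w != 0 ->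
  forall v, exists f : {ffun M -> F^o}, v = repr_act pi f w.
Proof.
move=> [_ irr_pi] w_neq0.
pose W : set V := [set v | exists f : {ffun M -> F^o}, v = repr_act pi f w]%classic.
have Ww : W w.
  (* The delta function at the identity acts trivially. *)
  exists [ffun m : M => (m == 1%g)%:R : F^o]; rewrite /repr_act (bigD1 (1%g : M)) //= big1.
    by rewrite ffunE eqxx scale1r addr0 repr1.
  by move=> m /negPf m_neq1; rewrite ffunE m_neq1 scale0r.
have [||W0|WT v] := irr_pi W.
- split=> [|a _ _ /set_mem[f ->] /set_mem[g ->]]; apply/mem_set.
    by exists 0; rewrite /repr_act big1 // => x _; rewrite ffunE scale0r.
  by exists (a *: f + g); rewrite repr_actP.
- move=> x _ /set_mem[f ->]; apply/mem_set; exact: repr_act_translate.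
- by move: Ww w_neq0; rewrite W0 => -> /[!eqxx].
- by have: W v by rewrite WT.
Qed.

End Cyclic.

Section Averaging.
Variables (F : fieldType) (M : finMonoidType) (K : {group unit_group M}).
Implicit Types f : {ffun M -> F^o}.

(** This is [f] convolved on both sides with [hecke_one K], after inverting the summation
    variables. *)
Definition biaverage f : {ffun M -> F^o} :=
  [ffun m => #|K|%:R^-1 * #|K|%:R^-1 *
     \sum_(k1 in K) \sum_(k2 in K) f (val k1 * m * val k2)%g].

Lemma biaverage_biinvariant f : biaverage f \in biinvariant F K.
Proof.
apply/biinvariantP => h1 h2 h1K h2K m; rewrite !ffunE; congr (_ * _).
rewrite [RHS](reindex_inj (mulIg h1)) /=.
apply: eq_big => [k1|k1 _]; first by rewrite groupMr.
rewrite [RHS](reindex_inj (mulgI h2)) /=.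
apply: eq_big => [k2|k2 _]; first by rewrite groupMl.
by rewrite !mulgA.
Qed.

(** Each two-sided [K]-translate of [f] acts on [w] as [f] does, hence so does their average. *)
Lemma repr_act_biaverage (charK : pchar_ndvd F #|K|) (V : lmodType F)
    (pi : representation M V) f (w : V) :
  w \in fixed_points pi K -> repr_act pi f w \in fixed_points pi K ->
  repr_act pi (biaverage f) w = repr_act pi f w.
Proof.
move=> /fixed_pointsP wK /fixed_pointsP fwK.
have cardK_neq0 : #|K|%:R != 0 :> F.
  exact: pchar_ndvd_neq0 (cardG_gt0 K) charK.
have translate k1 k2 : k1 \in K -> k2 \in K ->
    \sum_m f (val k1 * m * val k2)%g *: pi m w = repr_act pi f w.
  (* Inserting [pi] of [k1^-1] is harmless as [repr_act pi f w] is fixed. Substituting [k1 * m * k2]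
     for [m] then cancels [k1], and [w] absorbs [k2]. *)
  move=> k1K k2K; rewrite -[RHS](fwK k1^-1%g) ?groupV // linear_sum /=.
  rewrite [RHS](reindex (fun m => (val k1 * m * val k2)%g)) /=; last first.
    exists (fun m => (val k1^-1 * m * val k2^-1)%g) => m _.
      by rewrite -!mulgA val_unitVM mulgA val_unitMr.
    by rewrite -!mulgA val_unitMV mulgA val_unitMVr.
  apply: eq_bigr => m _.
  by rewrite linearZ /= -reprM -!mulgA val_unitVM reprM wK.
transitivity ((#|K|%:R^-1 * #|K|%:R^-1) *:
    \sum_(k1 in K) \sum_(k2 in K) \sum_m f (val k1 * m * val k2)%g *: pi m w).
  under [in RHS]eq_bigr do rewrite exchange_big /=.
  rewrite exchange_big scaler_sumr; apply: eq_bigr => m _ /=.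
  rewrite ffunE -[LHS]scalerA scaler_suml; congr (_ *: _).
  by apply: eq_bigr => k1 _; rewrite scaler_suml.
(* The [#|K|] squared equal terms cancel the two inverse factors. *)
under eq_bigr => k1 k1K do under eq_bigr => k2 k2K do rewrite translate //.
by rewrite !sumr_const -mulrnA -[X in _ *: X]scaler_nat natrM scalerA
  mulrACA mulVf // mulr1 scale1r.
Qed.

End Averaging.

Theorem theorem2p1 (M : finMonoidType) (K : {group unit_group M})
    (F : fieldType) (charK : pchar_ndvd F #|K|)
    (V : lmodType F) (pi : representation M V)
    (irr_pi : irreducible_representation pi)
    (VK_neq0 : exists2 v : V, v \in fixed_points pi K & v != 0) :
  @irreducible_module (hecke_algebra charK) (fixed_module pi charK).
Proof.
split=> [|W [W0 linW]].
  by have [v vK v_neq0] := VK_neq0; exists (Sub v vK); rewrite -(inj_eq val_inj).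
have [[w Ww w_neq0]|W_eq0] := pselect (exists2 w, W w & w != 0); last first.
  left; apply/seteqP; split=> [w Ww|_ ->] /=; last exact: set_mem W0.
  by have [//|w_neq0] := eqVneq w 0; case: W_eq0; exists w.
right; apply/seteqP; split=> // v _.
have vw_neq0 : val w != 0 by rewrite -(inj_eq val_inj) in w_neq0.
have [f def_v] := irreducible_cyclic irr_pi vw_neq0 (val v).
pose phi : hecke_algebra charK := Sub (biaverage K f) (biaverage_biinvariant K f).
(* The summand [0] matches the form [a *: u + v] of closure in [submod_closed]. *)
suff -> : v = phi *: w + 0 by apply/set_mem/linW => //; exact: mem_set.
rewrite addr0; apply: val_inj; rewrite def_v.
(* Averaging preserves the action because [repr_act pi f] sends [val w] to [val v], which is
   [K]-fixed. *)
by rewrite -[LHS](repr_act_biaverage charK (valP w)) // -def_v (valP v).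
Qed.
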